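(* Suppose $f(x,y)=\ell(x,y)^{d-2}p(x,y)$ is a real binary form of degree $d\ge 3$, where $\ell(x,y)\in\mathbb{R}[x,y]$ is a nonzero real linear form and $p(x,y)\in\mathbb{R}[x,y]$ is an irreducible (over $\mathbb{R}$) real quadratic form. Then $L_{\mathbb{R}}(f)=d-1$.
   Context: For a field $K\subseteq\mathbb{C}$ and a binary form (homogeneous polynomial in $x,y$) $f\in K[x,y]$ of degree $d$, the $K$-rank $L_K(f)$ is the smallest $r$ for which there exist $\lambda_j,\alpha_j,\beta_j\in K$ with $f(x,y)=\sum_{j=1}^r\lambda_j(\alpha_jx+\beta_jy)^d$. For $K=\mathbb{R}$ it is called the real Waring rank. *)

(* Defs.v *)
From HB Require Import structures.
From mathcomp Require Import all_boot all_order all_algebra.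
From mathcomp Require Export reals.
From mathcomp Require Export mpoly.

Set Implicit Arguments.
Unset Strict Implicit.
Unset Printing Implicit Defensive.

Import GRing.Theory.
Local Open Scope ring_scope.

Definition irreducible_elt (A : idomainType) (p : A) : Prop :=
  [/\ p != 0, p \isn't a GRing.unit &
      forall q r : A, p = q * r ->
        q \is a GRing.unit \/ r \is a GRing.unit].

(* The variables x and y are 'X_ord0 and 'X_ord_max in {mpoly K[2]}. *)
Definition linform (K : fieldType) (a b : K) : {mpoly K[2]} :=
  a *: 'X_ord0 + b *: 'X_ord_max.

Definition power_sum_repr (K : fieldType) (d : nat) (f : {mpoly K[2]})
    (r : nat) : Prop :=
  exists lambda alpha beta : 'I_r -> K,
    f = \sum_(j < r) lambda j *: linform (alpha j) (beta j) ^+ d.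

(* [is_rank d f r] reads L_K(f) = r for a binary form f of degree d.  It is a
   relation rather than a nat-valued function so that no junk value has to be
   chosen; r is unique when it exists.  The degree d is explicit because it
   cannot be read off from f = 0. *)
Definition is_rank (K : fieldType) (d : nat) (f : {mpoly K[2]})
    (r : nat) : Prop :=
  power_sum_repr d f r /\
  (forall s : nat, power_sum_repr d f s -> (r <= s)%N).

(* Main.v *)
Require Import Defs.
From mathcomp Require Import all_boot all_order all_algebra.
From mathcomp Require Import zify ring.
Import Order.TTheory GRing.Theory Num.Theory.
Local Open Scope ring_scope.

(* In suitable linear coordinates X and Y = l, irreducibility of p gives
   f = A X^2 Y^(d-2) + C Y^d with A C > 0.

   Lower bound: if f is the sum of s <= d - 2 terms lambda_j (a_j X + b_j Y)^d,
   the moments M_i = sum_j lambda_j a_j^i b_j^(d-i) vanish for i > 2 and M_2 is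
   not 0.  A monic polynomial P of degree d - 2 vanishing at every ratio
   b_j / a_j with a_j nonzero gives sum_k P_k M_(d-k) = 0, which reads M_2 = 0
   (terms with a_j = 0 contribute nothing, since d - k >= 2).

   Upper bound: f = sum_j w_j (X + t_j Y)^d amounts to prescribing
   m_k = sum_j w_j t_j^k for k <= d.  With n = d - 1 distinct nodes, Vandermonde
   weights achieve m_k = 0 for k < n - 1 and m_(n-1) = a; when the nodes sum to
   0, the recurrence given by prod_j (T - t_j) forces m_n = 0 and
   m_(n+1) = a * (sum_j t_j^2) / 2, a positive multiple of a that scaling the
   nodes makes arbitrary. *)

(** * Lower bound for sums of powers of univariate affine polynomials *)

Lemma coef_linear_exp (K : comNzRingType) (a b : K) (d i : nat) :
  (i <= d)%N ->
  ((a *: 'X + b%:P) ^+ d)`_i = a ^+ i * b ^+ (d - i) *+ 'C(d, i).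
Proof.
move=> le_id; rewrite addrC exprDn coef_sum.
have lt_id : (i < d.+1)%N by [].
rewrite (bigD1 (Ordinal lt_id)) //= big1 ?addr0 => [|j ne_ji];
  rewrite coefMn -polyC_exp coefCM exprZn coefZ coefXn /=.
  by rewrite eqxx mulr1 mulrC.
by rewrite eq_sym (negbTE ne_ji : (j == i :> nat) = false) !mulr0 mul0rn.
Qed.

(** The lower-bound argument for a dehomogenized form of degree [k.+1], with a monic [P] of degree
    [d - k.+1]; the theorem needs [k = 1]. *)
Lemma leq_power_sum_size (K : numFieldType) (d s k : nat) (q : {poly K})
    (lambda alpha beta : 'I_s -> K) :
  q = \sum_(j < s) lambda j *: (alpha j *: 'X + (beta j)%:P) ^+ d ->
  size q = k.+2 -> (d - k <= s)%N.
Proof.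
move=> def_q size_q; rewrite leqNgt; apply/negP=> lt_s.
(* If [alpha j = 0] then [u j = 0], a harmless extra root of [P]. The power of ['X] pads the degree
   to exactly [d - k.+1], which is at least [s] by [lt_s]. *)
pose u j := beta j / alpha j.
pose P : {poly K} := 'X^(d - k.+1 - s) * \prod_(j < s) ('X - (u j)%:P).
have monP : P \is monic by rewrite monicMl ?monicXn ?monic_prod_XsubC.
have sizeP : size P = (d - k.+1).+1.
  rewrite size_monicM ?monicXn ?monic_neq0 ?monic_prod_XsubC // size_polyXn.
  by rewrite size_prod_XsubC /index_enum -enumT size_enum_ord; lia.
have kd : (k < d)%N by lia.
have moment i : (i <= d)%N ->
    \sum_j lambda j * (alpha j ^+ i * beta j ^+ (d - i)) *+ 'C(d, i) = q`_i.
  move=> le_id; rewrite def_q coef_sum; apply: eq_bigr => j _.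
  by rewrite coefZ coef_linear_exp // mulrnAr.
have bin_neq0 i : (i <= d)%N -> 'C(d, i)%:R != 0 :> K.
  by move=> le_id; rewrite pnatr_eq0 -lt0n bin_gt0.
(* Only the top index survives: for smaller [i], [d - i] exceeds the degree of [q]. *)
have lhs : \sum_(i < (d - k.+1).+1) P`_i * (q`_(d - i) / 'C(d, d - i)%:R) =
    q`_k.+1 / 'C(d, k.+1)%:R.
  rewrite big_ord_recr /= big1 ?add0r => [|i _].
    have -> : (d - (d - k.+1) = k.+1)%N by lia.
    by have := monicP monP; rewrite lead_coefE sizeP /= => ->; rewrite mul1r.
  have := ltn_ord i => lt_i.
  by rewrite [q`__]nth_default ?mul0r ?mulr0 // size_q; lia.
have rhs : \sum_(i < (d - k.+1).+1) P`_i * (q`_(d - i) / 'C(d, d - i)%:R) = 0.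
  transitivity (\sum_(i < (d - k.+1).+1) \sum_(j < s)
      lambda j * (P`_i * (alpha j ^+ (d - i) * beta j ^+ i))).
    apply: eq_bigr => i _; have := ltn_ord i => lt_i.
    rewrite -moment ?leq_subr // sumrMnl -[in X in X / _]mulr_natr mulfK; last first.
      by rewrite bin_neq0 ?leq_subr.
    rewrite mulr_sumr; apply: eq_bigr => j _.
    have -> : (d - (d - i) = i)%N by lia.
    by rewrite mulrCA.
  rewrite exchange_big big1 //= => j _; rewrite -mulr_sumr.
  have [aj0|aj_neq0] := eqVneq (alpha j) 0.
    rewrite big1 ?mulr0 // => i _; have := ltn_ord i => lt_i.
    by rewrite aj0 expr0n (_ : (d - i == 0)%N = false) ?mul0r ?mulr0 //; lia.
  have Puj : P.[u j] = 0.
    by rewrite /P hornerM (bigD1 j) //= hornerM hornerXsubC subrr mul0r mulr0.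
  suff -> : \sum_(i < (d - k.+1).+1) P`_i * (alpha j ^+ (d - i) * beta j ^+ i) =
      alpha j ^+ d * P.[u j] by rewrite Puj !mulr0.
  rewrite (horner_coef_wide _ (eq_leq sizeP)) mulr_sumr.
  apply: eq_bigr => i _; have := ltn_ord i => lt_i.
  rewrite [RHS]mulrCA /u exprMn exprVn expfB_cond ?(negbTE aj_neq0); last by lia.
  by congr (_ * _); rewrite mulrAC -mulrA.
have: lead_coef q != 0 by rewrite lead_coef_eq0 -size_poly_eq0 size_q.
rewrite lead_coefE size_q => /negP; apply; move: lhs; rewrite rhs => /esym/eqP.
by rewrite mulf_eq0 invr_eq0 (negbTE (bin_neq0 _ kd)) orbF.
Qed.

(** * Real nodes and weights with prescribed moments *)

(* The factor 'X^2 shifts indices so that no coefficient index is negative when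
   s is short. *)
Lemma coefs_prod_XsubC (K : comNzRingType) (s : seq K) :
  let P : {poly K} := 'X^2 * \prod_(x <- s) ('X - x%:P) in
  [/\ P`_(size s).+2 = 1, P`_(size s).+1 = - \sum_(x <- s) x &
      P`_(size s) *+ 2 = (\sum_(x <- s) x) ^+ 2 - \sum_(x <- s) x ^+ 2].
Proof.
elim: s => [|x s [IH2 IH1 IH0]] /=.
  by rewrite !big_nil !mulr1 !coefXn /= mul0rn expr0n /= subrr oppr0.
rewrite !big_cons mulrCA mulrBl !coefB !coefXM /= !coefCM IH2 IH1.
rewrite [_`_(size s).+3]nth_default ?mulr0 ?subr0; last first.
  by apply: (leq_trans (size_polyMleq _ _)); rewrite size_polyXn size_prod_XsubC.
split=> //; first by rewrite mulr1 opprD addrC.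
case: (size s) IH0 {IH1 IH2} => [|n] IH0; rewrite mulrnBl IH0; ring.
Qed.

(** The integers below [n] are centred at their mean, then rescaled by a square root; since [1 < n],
    two of them differ and the sum of squares is positive. *)
Lemma centered_nodes (R : rcfType) (n : nat) (r : R) :
  (1 < n)%N -> 0 < r ->
  exists t : 'I_n -> R,
    [/\ injective t, \sum_i t i = 0 & \sum_i t i ^+ 2 = r].
Proof.
move=> n_gt1 r_gt0.
have n_neq0 : n%:R != 0 :> R by rewrite pnatr_eq0; lia.
pose mean : R := (\sum_(i < n) (i : nat)%:R) / n%:R.
pose v (i : 'I_n) : R := (i : nat)%:R - mean.
have v_inj : injective v by move=> i j /addIr/eqP; rewrite eqr_nat => /eqP/val_inj.
have sum_v : \sum_i v i = 0.
  by rewrite sumrB sumr_const card_ord -mulr_natr divfK // subrr.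
pose S := \sum_i v i ^+ 2.
have S_gt0 : 0 < S.
  rewrite lt_neqAle sumr_ge0 ?andbT => [|i _]; last exact: sqr_ge0.
  apply/eqP=> /esym S0; have n_gt0 : (0 < n)%N by lia.
  have v0 i : v i = 0.
    apply/eqP; rewrite -sqrf_eq0; apply/eqP.
    by apply: (psumr_eq0P _ S0) => // j _; exact: sqr_ge0.
  have: Ordinal n_gt0 = Ordinal n_gt1 by apply: v_inj; rewrite !v0.
  by move/(congr1 val).
pose c := Num.sqrt (r / S).
have c_gt0 : 0 < c by rewrite sqrtr_gt0 divr_gt0.
exists (fun i => c * v i); split.
- by move=> i j /(mulfI (lt0r_neq0 c_gt0))/v_inj.
- by rewrite -mulr_sumr sum_v mulr0.
under eq_bigr do rewrite exprMn.
by rewrite -mulr_sumr sqr_sqrtr ?divr_ge0 ?ltW // divfK // lt0r_neq0.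
Qed.

Lemma exists_weights (K : fieldType) (n : nat) (t : 'I_n.+1 -> K) (c : K) :
  injective t ->
  exists w : 'I_n.+1 -> K,
    forall k, (k <= n)%N -> \sum_j w j * t j ^+ k = if k == n then c else 0.
Proof.
move=> t_inj; pose V := Vandermonde n.+1 (\row_j t j).
have V_unit : V \in unitmx.
  rewrite unitmxE det_Vandermonde unitfE; apply/prodf_neq0 => i _.
  apply/prodf_neq0 => j lt_ij; rewrite !mxE subr_eq0 (inj_eq t_inj).
  by rewrite -val_eqE /= gtn_eqF.
(* Last column of the inverse Vandermonde matrix, scaled by [c]. *)
pose x := invmx V *m (c *: delta_mx ord_max 0 : 'cV_n.+1).
exists (fun j => x j 0) => k le_kn.
have := congr1 (fun A : 'cV_n.+1 => A (Ordinal (le_kn : (k < n.+1)%N)) 0)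
  (mulKVmx V_unit (c *: delta_mx ord_max 0 : 'cV_n.+1)).
rewrite !mxE eqxx andbT -val_eqE /= => eq_k.
transitivity (c * (k == n)%:R); last by case: eqP => _; rewrite ?mulr1 ?mulr0.
by rewrite -eq_k; apply: eq_bigr => j _; rewrite !mxE mulrC.
Qed.

Lemma exists_moments (R : rcfType) (n : nat) (a b : R) :
  (0 < n)%N -> 0 < a * b ->
  exists t w : 'I_n.+1 -> R, forall k, (k <= n.+2)%N ->
    \sum_j w j * t j ^+ k = if k == n then a else if k == n.+2 then b else 0.
Proof.
move=> n_gt0 ab_gt0.
have a_neq0 : a != 0 by apply: contraTneq ab_gt0 => ->; rewrite mul0r ltxx.
(* This is the sum of squares of the nodes that makes the last moment, [a] times half of it, equal
   to [b]. *)
have r_gt0 : 0 < (b / a) *+ 2.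
  rewrite pmulrn_lgt0 // (_ : b / a = a * b / a ^+ 2); last by field.
  by rewrite divr_gt0 // exprn_even_gt0.
have [t [t_inj sum_t sum_t2]] := @centered_nodes _ n.+1 _ n_gt0 r_gt0.
have [w w_mom] := exists_weights _ _ t a t_inj.
exists t, w.
pose m k := \sum_j w j * t j ^+ k.
pose s := [seq t j | j <- index_enum 'I_n.+1].
have size_s : size s = n.+1 by rewrite size_map /index_enum -enumT size_enum_ord.
have [] := coefs_prod_XsubC _ s.
set P := 'X^2 * _; rewrite size_s !big_map sum_t sum_t2 => P3 P2 P1.
(* The coefficients of [P] from index 2 on are those of the node polynomial, which vanishes at
   [t j]. *)
have recur j e : \sum_(k < n.+2) P`_k.+2 * t j ^+ (k + e) = 0.
  have: (\prod_(x <- s) ('X - x%:P)).[t j] = 0.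
    by rewrite big_map (bigD1 j) //= hornerM hornerXsubC subrr mul0r.
  rewrite (@horner_coef_wide _ n.+2) => [/(congr1 ( *%R^~ (t j ^+ e)))|]; last first.
    by rewrite size_prod_XsubC size_s.
  rewrite mul0r mulr_suml => eq0; rewrite -[RHS]eq0; apply: eq_bigr => k _.
  by rewrite exprD mulrA coefXnM /= subn2.
have mrecur e : \sum_(k < n.+2) P`_k.+2 * m (k + e)%N = 0.
  under eq_bigr do rewrite mulr_sumr.
  rewrite exchange_big big1 //= => j _.
  under eq_bigr do rewrite mulrCA.
  by rewrite -mulr_sumr recur mulr0.
have mlt k : (k < n)%N -> m k = 0.
  by move=> lt_kn; rewrite /m w_mom ?(ltnW lt_kn) // ltn_eqF.
have mn : m n = a by rewrite /m w_mom ?eqxx.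
have mSn : m n.+1 = 0.
  have := mrecur 0; rewrite !big_ord_recr /= big1 => [|k _].
    by rewrite P3 P2 oppr0 mul0r mul1r !add0r addn0.
  by rewrite addn0 mlt ?mulr0.
(* At [e = 1] three terms remain, with moments of index [n], [n.+1] and [n.+2]; the middle one is 0.
   Doubling the relation allows the use of [P1]. *)
have mSSn : m n.+2 = b.
  have := mrecur 1; rewrite -(prednK n_gt0) !big_ord_recr /= big1 => [|k _].
    rewrite !prednK // P3 P2 !addn1 prednK // mn mSn mulr0 addr0 mul1r add0r.
    move=> /(congr1 (fun x => x *+ 2)); rewrite mulrnDl -mulrnAl P1.
    rewrite expr0n /= sub0r mul0rn mulNr mulrnAl divfK // => eq0.
    by apply: (@mulIf _ 2%:R); rewrite ?pnatr_eq0 // !mulr_natr -[RHS]add0r -eq0; ring.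
  by have := ltn_ord k => lt_k; rewrite addn1 mlt ?mulr0 //; lia.
move=> k; rewrite -/(m k); case: (ltngtP k n) => [lt_kn _|lt_nk|-> _]; last exact: mn.
  by rewrite ifF ?mlt //; lia.
rewrite leq_eqVlt => /predU1P[->|lt_k]; first by rewrite eqxx.
by rewrite (_ : k = n.+1) ?mSn ?ltn_eqF //; lia.
Qed.

(** * Binary forms of degree 1 and 2, and adapted coordinates *)

Lemma linformD (K : fieldType) (a b a' b' : K) :
  linform a b + linform a' b' = linform (a + a') (b + b').
Proof. by rewrite /linform !scalerDl addrACA. Qed.

Lemma linformZ (K : fieldType) (c a b : K) :
  c *: linform a b = linform (c * a) (c * b).
Proof. by rewrite /linform scalerDr !scalerA. Qed.

Lemma mpolyX2E (K : fieldType) (m : 'X_{1.. 2}) :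
  'X_[K, m] = 'X_ord0 ^+ m ord0 * 'X_ord_max ^+ m ord_max.
Proof.
rewrite mpolyXE_id big_ord_recl big_ord1.
by rewrite (_ : lift _ _ = ord_max) //; apply: val_inj.
Qed.

Lemma mdeg2E (m : 'X_{1.. 2}) : mdeg m = (m ord0 + m ord_max)%N.
Proof.
rewrite mdegE big_ord_recl big_ord1.
by rewrite (_ : lift _ _ = ord_max) //; apply: val_inj.
Qed.

Lemma dhomog1_linform (K : fieldType) (l : {mpoly K[2]}) :
  l \is 1.-homog -> exists a b, l = linform a b.
Proof.
move=> /dhomogP hom_l; rewrite [l]mpolyE big_seq.
elim/big_rec: _ => [|m q m_l [a [b ->]]].
  by exists 0, 0; rewrite /linform !scale0r addr0.
have: mdeg m = 1%N := hom_l m m_l; rewrite mdeg2E mpolyX2E.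
case: (m ord0) (m ord_max) => [|[|i]] [|[|j]] //= _; rewrite expr0 expr1 ?mul1r ?mulr1.
  by exists a, (l@_m + b); rewrite /linform scalerDl addrCA.
by exists (l@_m + a), b; rewrite /linform scalerDl addrA.
Qed.

Lemma dhomog2_quadratic (K : fieldType) (p : {mpoly K[2]}) :
  p \is 2.-homog ->
  exists a b c, p = a *: 'X_ord0 ^+ 2 + b *: ('X_ord0 * 'X_ord_max)
                    + c *: 'X_ord_max ^+ 2.
Proof.
move=> /dhomogP hom_p; rewrite [p]mpolyE big_seq.
elim/big_rec: _ => [|m q m_p [a [b [c ->]]]].
  by exists 0, 0, 0; rewrite !scale0r !addr0.
have: mdeg m = 2%N := hom_p m m_p; rewrite mdeg2E mpolyX2E.
case: (m ord0) (m ord_max) => [|[|[|i]]] [|[|[|j]]] //= _;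
  rewrite ?expr0 ?expr1 ?mul1r ?mulr1.
- by exists a, b, (p@_m + c); rewrite scalerDl addrCA.
- by exists a, (p@_m + b), c; rewrite scalerDl addrA addrCA.
by exists (p@_m + a), b, c; rewrite scalerDl !addrA.
Qed.

(** Evaluation at the origin is a ring morphism that sends the form to 0. *)
Lemma linform_nonunit (K : fieldType) (a b : K) :
  linform a b \isn't a GRing.unit.
Proof.
apply/negP=> /(rmorph_unit (meval (fun=> 0))).
by rewrite /linform /= mevalD !mevalZ !mevalXU !mulr0 addr0 unitr0.
Qed.

Lemma irreducible_neq_linformM (K : fieldType) (p : {mpoly K[2]}) (a b a' b' : K) :
  irreducible_elt p -> p <> linform a b * linform a' b'.
Proof.
by case=> _ _ irr_p /irr_p[]; apply/negP; exact: linform_nonunit.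
Qed.

(* The new variable is X = -b x + a y + e l: the first two terms make it
   independent of l, the last one completes the square. *)
Lemma irreducible_quadratic_diag (R : rcfType) (a b : R) (p : {mpoly R[2]}) :
  a ^+ 2 + b ^+ 2 != 0 -> p \is 2.-homog -> irreducible_elt p ->
  exists A C e : R, 0 < A * C /\
    p = A *: linform (e * a - b) (e * b + a) ^+ 2 + C *: linform a b ^+ 2.
Proof.
move=> N_neq0 /dhomog2_quadratic[p0 [p1 [p2 def_p]]] irr_p.
pose N := a ^+ 2 + b ^+ 2.
(* With [Z = - b x + a y] and [l = a x + b y], these coefficients come from substituting
   [N x = a l - b Z] and [N y = b l + a Z] in [N ^+ 2 *: p]. *)
pose A := p0 * b ^+ 2 - p1 * (a * b) + p2 * a ^+ 2.
pose B := p1 * (a ^+ 2 - b ^+ 2) + (p2 - p0) * (a * b) *+ 2.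
pose C := p0 * a ^+ 2 + p1 * (a * b) + p2 * b ^+ 2.
have N2p : N ^+ 2 *: p = A *: linform (- b) a ^+ 2 +
    B *: (linform (- b) a * linform a b) + C *: linform a b ^+ 2.
  by rewrite def_p /A /B /C /N /linform -!mul_mpolyC; ring.
have N2_neq0 : N ^+ 2 != 0 by rewrite expf_neq0.
clearbody A B C; clear def_p p0 p1 p2.
pose A' := A / N ^+ 2; pose B' := B / N ^+ 2; pose C' := C / N ^+ 2.
have def_p : p = A' *: linform (- b) a ^+ 2 +
    B' *: (linform (- b) a * linform a b) + C' *: linform a b ^+ 2.
  apply: (scalerI N2_neq0); rewrite N2p !scalerDr !scalerA.
  by congr (_ *: _ + _ *: _ + _ *: _); rewrite mulrC divfK.
clearbody A' B' C'; clear A B C N2p; move: A' B' C' def_p => A B C def_p.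
have A_neq0 : A != 0.
  (* Otherwise [l] divides [p]. *)
  apply/eqP=> A0.
  apply: (@irreducible_neq_linformM _ _ a b (C * a - B * b) (B * a + C * b) irr_p).
  by rewrite def_p A0 /linform -!mul_mpolyC; ring.
pose e := B / (A *+ 2).
pose D := C - A * e ^+ 2.
have def_B : B = A * e *+ 2 by rewrite /e; field.
have def_C : C = D + A * e ^+ 2 by rewrite /D subrK.
clearbody e D.
have diag_p : p = A *: linform (e * a - b) (e * b + a) ^+ 2 + D *: linform a b ^+ 2.
  by rewrite def_p def_B def_C /linform -!mul_mpolyC; ring.
exists A, D, e; split=> //; rewrite ltNge; apply/negP=> AD_le0.
(* If [A * D <= 0], then [p = A (X - s l) (X + s l)], against irreducibility. *)
pose s := Num.sqrt (- (D / A)).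
have def_D : D = - (A * s ^+ 2).
  rewrite sqr_sqrtr; first by field.
  rewrite (_ : D / A = A * D / A ^+ 2); last by field.
  by rewrite oppr_ge0 pmulr_lle0 // invr_gt0 exprn_even_gt0.
clearbody s.
apply: (@irreducible_neq_linformM _ _ (A * (e * a - b - s * a)) (A * (e * b + a - s * b))
  (e * a - b + s * a) (e * b + a + s * b) irr_p).
by rewrite diag_p def_D /linform -!mul_mpolyC; ring.
Qed.

(** [hx] and [hy] solve [X = 'X], [l = 1] for [x] and [y]; the determinant of this system is [- N],
    whatever [e] is. *)
Lemma dehomogenization (K : fieldType) (a b e : K) :
  a ^+ 2 + b ^+ 2 != 0 ->
  exists psi : {rmorphism {mpoly K[2]} -> {poly K}},
    [/\ forall c q, psi (c *: q) = c *: psi q,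
        psi (linform (e * a - b) (e * b + a)) = 'X, psi (linform a b) = 1 &
        forall u v, exists u' v', psi (linform u v) = u' *: 'X + v'%:P].
Proof.
move=> N_neq0; pose N := a ^+ 2 + b ^+ 2.
pose hx : {poly K} := (- b / N) *: 'X + ((a + e * b) / N)%:P.
pose hy : {poly K} := (a / N) *: 'X + ((b - e * a) / N)%:P.
pose psi : {rmorphism {mpoly K[2]} -> {poly K}} :=
  mmap polyC (fun i : 'I_2 => if i == ord0 then hx else hy).
have psiZ c q : psi (c *: q) = c *: psi q by rewrite /psi /= mmapZ mul_polyC.
have psi_lin u v : psi (linform u v) = u *: hx + v *: hy.
  by rewrite /linform rmorphD /= !psiZ /psi /= !mmapX !mmap1U.
have psi_linE u v : psi (linform u v) =
   ((v * a - u * b) / N) *: 'X + ((u * (a + e * b) + v * (b - e * a)) / N)%:P.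
  by rewrite psi_lin /hx /hy -!mul_polyC; ring.
exists psi; split=> //.
- rewrite psi_linE (_ : _ / N = 1) ?scale1r; last by rewrite /N; field.
  by rewrite (_ : _ / N = 0) ?addr0 // /N; field.
- rewrite psi_linE (_ : _ / N = 0) ?scale0r ?add0r; last by rewrite /N; field.
  by rewrite (_ : _ / N = 1) // /N; field.
by move=> u v; eexists; eexists; exact: psi_linE.
Qed.

(** * The two bounds for the diagonalized form, and the theorem *)

(** Setting [l = 1] turns [f] into [A *: 'X^2 + C%:P], of size 3 because [A != 0];
    [leq_power_sum_size] then applies with [k = 1]. *)
Lemma leq_power_sum_repr (K : numFieldType) (d s : nat) (a b e A C : K)
    (f : {mpoly K[2]}) :
  a ^+ 2 + b ^+ 2 != 0 -> A != 0 ->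
  f = linform a b ^+ (d - 2) *
      (A *: linform (e * a - b) (e * b + a) ^+ 2 + C *: linform a b ^+ 2) ->
  power_sum_repr d f s -> (d - 1 <= s)%N.
Proof.
move=> N_neq0 A_neq0 def_f [lambda [alpha [beta f_sum]]].
have [psi [psiZ psiX psi1 psi_lin]] := @dehomogenization _ a b e N_neq0.
have /fin_all_exists[u /fin_all_exists[v uvE]] j := psi_lin (alpha j) (beta j).
apply: (@leq_power_sum_size _ d s 1 (psi f) lambda u v).
  rewrite f_sum rmorph_sum; apply: eq_bigr => j _.
  by rewrite psiZ rmorphXn /= uvE.
rewrite def_f rmorphM /= rmorphXn /= psi1 expr1n mul1r rmorphD /= !psiZ.
rewrite !rmorphXn /= psi1 psiX expr1n alg_polyC size_polyDl size_scale ?size_polyXn //.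
by rewrite ltnS (leq_trans (size_polyC_leq1 C)).
Qed.

Lemma power_sum_repr_diag (R : rcfType) (n : nat) (a b a' b' A C : R)
    (f : {mpoly R[2]}) :
  (0 < n)%N -> 0 < A * C ->
  f = linform a b ^+ n *
      (A *: linform a' b' ^+ 2 + C *: linform a b ^+ 2) ->
  power_sum_repr n.+2 f n.+1.
Proof.
move=> n_gt0 AC_gt0 def_f.
have bin_gt0R : 0 < 'C(n.+2, 2)%:R :> R by rewrite ltr0n bin_gt0.
have bin_neq0 := lt0r_neq0 bin_gt0R.
(* In the expansion of the powers of [X + t j l], the moment of index [n] comes with the factor
   ['C(n.+2, 2)], hence the division. *)
have [t [w]] : exists t w : 'I_n.+1 -> R, forall k, (k <= n.+2)%N ->
    \sum_j w j * t j ^+ k =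
      if k == n then A / 'C(n.+2, 2)%:R else if k == n.+2 then C else 0.
  by apply: exists_moments; rewrite // mulrAC divr_gt0.
pose m k := \sum_j w j * t j ^+ k; move=> mom0.
have mom k : (k <= n.+2)%N -> m k =
  if k == n then A / 'C(n.+2, 2)%:R else if k == n.+2 then C else 0 by exact: mom0.
exists w, (fun j => a' + t j * a), (fun j => b' + t j * b).
under eq_bigr => j _ do rewrite -linformD -linformZ exprDn scaler_sumr.
rewrite exchange_big /= def_f.
transitivity (\sum_(i < n.+3) m i *:
    (linform a' b' ^+ (n.+2 - i) * linform a b ^+ i *+ 'C(n.+2, i))).
  rewrite !big_ord_recr /= big1 => [|i _]; last first.
    by have := ltn_ord i => lt_i; rewrite mom ?ltn_eqF ?scale0r //; lia.
  have -> : m n = A / 'C(n.+2, 2)%:R by rewrite mom ?eqxx //; lia.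
  have -> : m n.+1 = 0 by rewrite mom // !ifF //; lia.
  have -> : m n.+2 = C by rewrite mom // eqxx ifF //; lia.
  have -> : (n.+2 - n = 2)%N by lia.
  have -> : 'C(n.+2, n) = 'C(n.+2, 2) by rewrite -[RHS]bin_sub // !subSS subn0.
  rewrite binn subnn mulr1n mul1r scale0r addr0 add0r -scaler_nat scalerA divfK //.
  by rewrite mulrDr -!scalerAr -exprD addn2 [_ ^+ n * _]mulrC.
apply: eq_bigr => i _; rewrite scaler_suml; apply: eq_bigr => j _.
by rewrite exprZn -scalerAr !scalerMnr scalerA.
Qed.

Theorem corollary3p3 (R : realType) (d : nat) (f l p : {mpoly R[2]})
    (hd : (3 <= d)%N)
    (hf : f \is d.-homog)
    (hl : l \is 1.-homog) (hl0 : l != 0)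
    (hp : p \is 2.-homog) (hpirr : irreducible_elt p)
    (hflp : f = l ^+ (d - 2) * p) :
  is_rank d f (d - 1).
Proof.
have [a [b def_l]] := dhomog1_linform _ _ hl.
have N_neq0 : a ^+ 2 + b ^+ 2 != 0.
  apply: contra_neq hl0 => /eqP.
  rewrite paddr_eq0 ?sqr_ge0 // !sqrf_eq0 => /andP[/eqP a0 /eqP b0].
  by rewrite def_l a0 b0 /linform !scale0r addr0.
have [A [C [e [AC_gt0 def_p]]]] := irreducible_quadratic_diag _ _ _ _ N_neq0 hp hpirr.
rewrite {}def_l {}def_p {l p hl hl0 hp hpirr} in hflp.
have A_neq0 : A != 0 by apply: contraTneq AC_gt0 => ->; rewrite mul0r ltxx.
split=> [|s]; last exact: leq_power_sum_repr hflp.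
have -> : (d - 1 = (d - 2).+1)%N by lia.
rewrite [d in power_sum_repr d](_ : d = (d - 2).+2); last by lia.
apply: power_sum_repr_diag hflp => //; lia.
Qed.
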